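(* The Polish Algorithm for central duplication $abc{*}{*} = ab{*}bc{*}{*}$ (that is, $a(bc)=(ab)(bc)$) terminates for every pair of terms $u, v \in \mathbf{T}$ with $\mathrm{depth}(u) \le 10$ and $\mathrm{depth}(v)\le 10$.
   Context: Terms. $\mathbf{T}$ is the set of terms in one variable $x$ and one binary operation symbol $*$ in right Polish notation: it is the smallest set of finite words over the alphabet $\{x,*\}$ with $x \in \mathbf{T}$ and $st* \in \mathbf{T}$ whenever $s,t\in\mathbf{T}$ (the word $st*$ represents the product $s\cdot t$). The depth of a term is its number of occurrences of $x$. A term $v$ is viewed as a word $v(0)v(1)\cdots v(n-1)$ with $n=\mathrm{length}(v)$. First difference. For $u,v\in\mathbf{T}$, $d(u,v)$ is the least $i<\min(\mathrm{length}(u),\mathrm{length}(v))$ with $u(i)\ne v(i)$ if such an $i$ exists, and $d(u,v)=\infty$ otherwise. Dynamic range. Let $d=d(u,v)<\infty$ and $v(d)=*$ (so $u(d)=x$). Then $u$ and $v$ can be written uniquely as $$u = A\,u_0\,u_1\,u_2 * u_3 * \cdots u_n * *\, B,\qquad v = A\,u_0\,u_1 *\, C,$$ where $n\ge 2$, $u_0,\dots,u_n\in\mathbf{T}$, $A,B,C$ are strings, and the first letter of $u_2$ is at position $d$ in $u$ (so the displayed subterm of $u$ is $u_0\cdot((\cdots((u_1\cdot u_2)\cdot u_3)\cdots)\cdot u_n)$). Polish Algorithm for central duplication. Given $(u,v)$, stop if $d(u,v)=\infty$. Otherwise let $d=d(u,v)$. If $v(d)=*$, put $v'=v$ and, with the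 notation above, $$u' = A\,u_0\,u_1 *\, u_1\,u_2 **\, z_3\,u_3 **\, z_4\,u_4 ** \cdots z_n\,u_n **\, B ,$$ where $z_k = u_1\,u_2 * u_3 * \cdots u_{k-1} *$ for $3\le k\le n$ (i.e. $z_k=(\cdots((u_1\cdot u_2)\cdot u_3)\cdots)\cdot u_{k-1}$). If $u(d)=*$, put $u'=u$ and define $v'$ analogously with the roles of $u$ and $v$ exchanged. Passing from $(u,v)$ to $(u',v')$ is one step. The algorithm repeats steps; it terminates on $(u,v)$ if after finitely many steps it reaches a pair $(u^*,v^* )$ with $d(u^*,v^* )=\infty$. *)

(* Defs.v *)
From HB Require Import structures.
From mathcomp Require Import all_boot.

Set Implicit Arguments.
Unset Strict Implicit.
Unset Printing Implicit Defensive.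

Inductive letter := lx | lstar.

Definition letter_eqb (a b : letter) : bool :=
  match a, b with
  | lx, lx | lstar, lstar => true
  | _, _ => false
  end.

Lemma letter_eqP : Equality.axiom letter_eqb.
Proof. by case; case; constructor. Qed.

HB.instance Definition _ := hasDecEq.Build letter letter_eqP.

Definition word := seq letter.

Inductive term : word -> Prop :=
| term_x : term [:: lx]
| term_op s t : term s -> term t -> term (s ++ t ++ [:: lstar]).

Definition depth (v : word) : nat := count_mem lx v.

(* [None] stands for infinity.  [zip u v] has length
   [minn (size u) (size v)], and [find] returns that length when the two words
   agree on their common range. *)
Definition first_diff (u v : word) : option nat :=
  let i := find (fun p : letter * letter => p.1 != p.2) (zip u v) in
  if i < minn (size u) (size v) then Some i else None.

(* The words u_0, ..., u_n are given by t 0, ..., t n; the values of t beyond n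
   are irrelevant. *)

(* u_i * u_{i+1} * ... u_{j-1} * *)
Definition starred (t : nat -> word) (i j : nat) : word :=
  \big[cat/[::]]_(i <= l < j) (t l ++ [:: lstar]).

(* z_k = u_1 u_2 * u_3 * ... u_{k-1} * *)
Definition zterm (t : nat -> word) (k : nat) : word := t 1 ++ starred t 2 k.

(* u is the term that gets rewritten (v has the star at the first difference).
   The decomposition is unique, so the existential quantifiers below lose
   nothing: expand is a partial function of (u, v).  The size condition says
   that the first letter of u_2 is at position d in u. *)
Definition expand (u v u' : word) : Prop :=
  exists (d n : nat) (t : nat -> word) (A B C : word),
    [/\ first_diff u v = Some d /\ nth lx v d = lstar,
        2 <= n /\ (forall i, i <= n -> term (t i)),
        u = A ++ t 0 ++ t 1 ++ starred t 2 n.+1 ++ [:: lstar] ++ B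
          /\ size (A ++ t 0 ++ t 1) = d,
        v = A ++ t 0 ++ t 1 ++ [:: lstar] ++ C
      & u' = A ++ t 0 ++ t 1 ++ [:: lstar] ++ t 1 ++ t 2 ++ [:: lstar; lstar]
               ++ \big[cat/[::]]_(3 <= k < n.+1)
                     (zterm t k ++ t k ++ [:: lstar; lstar])
               ++ B].

Definition polish_step (p q : word * word) : Prop :=
  (expand p.1 p.2 q.1 /\ q.2 = p.2) \/ (expand p.2 p.1 q.2 /\ q.1 = p.1).

Inductive polish_reaches (p : word * word) : word * word -> Prop :=
| reaches_refl : polish_reaches p p
| reaches_step q r : polish_reaches p q -> polish_step q r -> polish_reaches p r.

Definition polish_terminates (u v : word) : Prop :=
  exists u' v' : word,
    polish_reaches (u, v) (u', v') /\ first_diff u' v' = None.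

(* Main.v *)
Require Import Defs.
From mathcomp Require Import all_boot.

(** A term is x applied to a list of arguments, [x t_1 * ... t_n *].  Read on
    such lists, the algorithm compares the first arguments recursively; when one
    of them becomes a proper prefix [t] of the other, [t r_1 * ... r_k *], the
    latter is replaced by the whole chain [t], [t r_1 *], ..., [t r_1 * ... r_k *]
    of its prefixes, the two copies of [t] are skipped, and the comparison goes on.

    Termination comes from placing both terms in a common finite frame, for terms
    of any depth.  A frame is a sequence of naturals l_0 = 0, l_1, l_2, ... with
    l_(q+1) <= l_q + 1; the index a stands for the term whose arguments are the
    terms of indices l_0, ..., l_(a-1).  A list t_1, ..., t_n lives in the frame
    if there are positions b_1 < ... < b_n such that t_i recursively lives at
    index l_(b_i) and l is smaller than l_(b_i) between b_(i-1) and b_i (the skipped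
    entries are prefixes the algorithm may still insert).  As l grows by at most one
    at a time, each prefix inserted by the algorithm finds its own position in the
    frame.  So both words stay in the frame while the position reached by the
    comparison increases, and it is bounded.  A frame for all terms
    with few arguments is obtained by repeating: (0 0 ... 0 1) (0 ... 0 1) ... 2 ... *)

Set Implicit Arguments.
Unset Strict Implicit.
Unset Printing Implicit Defensive.

(** * First differences, and runs inside a context *)

Lemma first_diff_cons x y u v :
  first_diff (x :: u) (y :: v) =
  if x == y then omap S (first_diff u v) else Some 0.
Proof.
by rewrite /first_diff /= minnSS ltnS; case: eqP => //= _; case: ifP.
Qed.

Lemma first_diff_cat A u v :
  first_diff (A ++ u) (A ++ v) = omap (addn (size A)) (first_diff u v).
Proof.
elim: A => [|x A IH] /=; first by case: (first_diff u v).
by rewrite first_diff_cons eqxx IH; case: (first_diff u v).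
Qed.

Lemma first_diff_extend u v B C d :
  first_diff u v = Some d -> first_diff (u ++ B) (v ++ C) = Some d.
Proof.
elim: u v d => [|x u IH] [|y v] d //=.
rewrite !first_diff_cons; case: eqP => // _.
by case E: (first_diff u v) => [e|] //= [<-]; rewrite (IH _ _ E).
Qed.

Lemma first_diff_prefix u w : first_diff u (u ++ w) = None.
Proof.
elim: u => [|x u IH] /=; first by rewrite /first_diff min0n.
by rewrite first_diff_cons eqxx IH.
Qed.

Lemma first_diffC u v : first_diff u v = first_diff v u.
Proof.
elim: u v => [|x u IH] [|y v] //; rewrite !first_diff_cons eq_sym.
by case: eqP => // _; rewrite IH.
Qed.

(** The first difference is decided inside [u] and [v]: [A] only shifts it, and the suffixes may
    differ. So a run on two first arguments can be replayed inside the whole words. *)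
Lemma expand_context A B C u v u' :
  expand u v u' -> expand (A ++ u ++ B) (A ++ v ++ C) (A ++ u' ++ B).
Proof.
case=> d [n [t [A0 [B0 [C0]]]]] [[fd _] tn [uE dE] vE ->].
exists (size A + d), n, t, (A ++ A0), (B0 ++ B), (C0 ++ C); split=> //.
- rewrite first_diff_cat (first_diff_extend _ _ fd); split=> //.
  rewrite nth_cat ltnNge leq_addr /= addKn vE.
  rewrite (_ : _ ++ _ = (A0 ++ t 0 ++ t 1) ++ lstar :: C0 ++ C).
    by rewrite nth_cat dE ltnn subnn.
  by rewrite -!catA.
- by split; [rewrite uE -!catA | rewrite -!catA size_cat dE].
- by rewrite vE -!catA.
- by rewrite -!catA.
Qed.

Lemma polish_reaches_trans p q r :
  polish_reaches p q -> polish_reaches q r -> polish_reaches p r.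
Proof. by move=> pq; elim=> // q' r' _ IH st; apply: reaches_step IH st. Qed.

Lemma polish_reaches_context A B C u v u' v' :
  polish_reaches (u, v) (u', v') ->
  polish_reaches (A ++ u ++ B, A ++ v ++ C) (A ++ u' ++ B, A ++ v' ++ C).
Proof.
have gen q : polish_reaches (u, v) q -> polish_reaches
    (A ++ u ++ B, A ++ v ++ C) (A ++ q.1 ++ B, A ++ q.2 ++ C).
  elim=> [|q1 r _ IH st]; first exact: reaches_refl.
  apply: reaches_step IH _.
  by case: st => [[e ->]|[e ->]]; [left|right]; split=> //=;
     apply: expand_context.
exact: gen.
Qed.

Lemma polish_reaches_sym u v u' v' :
  polish_reaches (u, v) (u', v') -> polish_reaches (v, u) (v', u').
Proof.
have gen q : polish_reaches (u, v) q -> polish_reaches (v, u) (q.2, q.1).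
  elim=> [|q1 r _ IH st]; first exact: reaches_refl.
  by apply: reaches_step IH _; case: st; [right|left].
exact: gen.
Qed.

Lemma polish_reaches_expand u v u' :
  expand u v u' -> polish_reaches (u, v) (u', v).
Proof. by move=> e; apply: reaches_step (reaches_refl _) _; left. Qed.

(** * Terms as lists of arguments *)

Definition args (ts : seq word) : word :=
  flatten [seq t ++ [:: lstar] | t <- ts].

Definition comb (ts : seq word) : word := lx :: args ts.

Lemma args_cat ts ss : args (ts ++ ss) = args ts ++ args ss.
Proof. by rewrite /args map_cat flatten_cat. Qed.

Lemma args_cons t ts : args (t :: ts) = t ++ lstar :: args ts.
Proof. by rewrite /args /= -catA. Qed.

Lemma args_rcons ts t : args (rcons ts t) = args ts ++ t ++ [:: lstar].
Proof. by rewrite -cats1 args_cat args_cons. Qed.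

Lemma comb_rcons ts t : comb (rcons ts t) = comb ts ++ t ++ [:: lstar].
Proof. by rewrite /comb args_rcons. Qed.

Lemma args_bigE ts : args ts = \big[cat/[::]]_(t <- ts) (t ++ [:: lstar]).
Proof. by elim: ts => [|t ts IH]; rewrite ?big_nil // big_cons -IH. Qed.

Fixpoint extensions (w : word) (ts : seq word) : seq word :=
  if ts is t :: ts' then
    let w' := w ++ t ++ [:: lstar] in w' :: extensions w' ts'
  else [::].

Lemma size_extensions w ts : size (extensions w ts) = size ts.
Proof. by elim: ts w => //= t ts IH w; rewrite IH. Qed.

Lemma nth_extensions w ts i : i < size ts ->
  nth [::] (extensions w ts) i
  = w ++ args (take i ts) ++ nth [::] ts i ++ [:: lstar].
Proof.
elim: ts w i => [|t ts IH] w [|i] //= lt_i.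
by rewrite IH // args_cons -!catA.
Qed.

(** Here [u_0 = p], [u_1 = w], and the head [lx :: t] supplies the letter [x] facing the star. Each
    [z_k u_k *] is an entry of [extensions], with [z_2 = u_1]. *)
Lemma expand_args p w t ts B C : term p -> term w ->
  (forall s, s \in (lx :: t) :: ts -> term s) ->
  expand (p ++ w ++ args ((lx :: t) :: ts) ++ lstar :: B)
         (p ++ w ++ lstar :: C)
         (p ++ w ++ lstar :: args (extensions w ((lx :: t) :: ts)) ++ B).
Proof.
move=> tp tw; set ss := _ :: ts => tss.
pose f := nth [::] (p :: w :: ss).
have starredE i : i <= size ss -> starred f 2 (i + 2) = args (take i ss).
  move=> le_i; rewrite /starred (big_addn 0 _ 2) addnK args_bigE (big_nth [::]).
  rewrite size_takel //; apply: eq_big_nat => k lt_k.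
  by rewrite /f addn2 /= nth_take.
have szE : (size ss).+2 = size ss + 2 by rewrite addn2.
exists (size (p ++ w)), (size ss).+1, f, [::], B, C; split.
- rewrite !(catA p w) first_diff_cat /ss args_cons first_diff_cons /=.
  rewrite addn0; split=> //.
  by rewrite nth_cat ltnn subnn.
- split=> // -[|[|i]] // le_i.
  by apply: tss; rewrite /f /= mem_nth // -ltnS.
- split; last by [].
  by rewrite szE starredE // take_size.
- by [].
- rewrite /= /f /=; congr (_ ++ (_ ++ _ :: _)).
  set F := fun k => zterm f k ++ f k ++ [:: lstar; lstar].
  have -> : args (extensions w ss) = \big[cat/[::]]_(2 <= k < (size ss).+2) F k.
    rewrite szE (big_addn 0 _ 2) addnK args_bigE (big_nth [::]) size_extensions.
    apply: eq_big_nat => k /andP[_ lt_k].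
    rewrite /F /zterm starredE 1?ltnW // nth_extensions // /f addn2 /=.
    by rewrite -!catA.
  rewrite big_ltn // /F /zterm /starred big_geq // cats0 /f /=.
  by rewrite -!catA /= -!catA.
Qed.

(** * Embedding lists of arguments into a slowly increasing sequence *)

(* [embed l a ts b]: the words [ts] are placed in [l] at positions from [a] on, the
   last one at position [b.-1] ([b = a] if [ts] is empty). *)
Inductive embed (l : seq nat) : nat -> seq word -> nat -> Prop :=
| embed_nil a : embed l a [::] a
| embed_cons a b c ss ts :
    a <= b -> b < size l ->
    (forall q, a <= q < b -> nth 0 l q < nth 0 l b) ->
    embed l 0 ss (nth 0 l b) -> embed l b.+1 ts c ->
    embed l a (comb ss :: ts) c.

Definition slow (l : seq nat) : Prop :=
  nth 0 l 0 = 0 /\ forall q, nth 0 l q.+1 <= (nth 0 l q).+1.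

Lemma slow_le l q : slow l -> nth 0 l q <= q.
Proof.
case=> l0 lS; elim: q => [|q IH]; first by rewrite l0.
exact: leq_trans (lS q) _.
Qed.

(** At the least [k >= i] with [l_k >= x], growth by at most one forces equality. *)
Lemma slow_ivt l i j x : slow l -> i <= j ->
  nth 0 l i < x <= nth 0 l j ->
  exists k, [/\ i < k <= j, nth 0 l k = x
              & forall q, i <= q < k -> nth 0 l q < x].
Proof.
move=> [_ lS] le_ij /andP[lt_ix le_xj].
have ex : exists k, (i <= k) && (x <= nth 0 l k).
  by exists j; rewrite le_ij.
case: (ex_minnP ex) => k /andP[le_ik le_xk] min_k.
have lt_below q : i <= q < k -> nth 0 l q < x.
  case/andP=> le_iq lt_qk; rewrite ltnNge; apply/negP=> le_xq.
  by have := min_k q; rewrite le_iq le_xq leqNgt lt_qk => /(_ isT).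
have lt_ik : i < k.
  rewrite ltn_neqAle le_ik andbT; apply: contraTneq lt_ix => ->.
  by rewrite -leqNgt.
exists k; split=> //; first by rewrite lt_ik min_k // le_ij.
apply/eqP; rewrite eqn_leq le_xk andbT.
case: k lt_ik lt_below {le_ik le_xk min_k} => // k; rewrite ltnS => le_ik lt_b.
by apply: leq_trans (lS k) _; apply: lt_b; rewrite le_ik leqnn.
Qed.

Lemma embed_le l a ts b : embed l a ts b -> a <= b.
Proof.
elim=> // a' b' c ss ts' le_ab _ _ _ _ _ lt_bc.
exact: leq_trans le_ab (ltnW lt_bc).
Qed.

Lemma embed_loop l a ts : embed l a ts a -> ts = [::].
Proof.
move=> e; inversion e as [|? b ? ss ? le_ab _ _ _ e']; subst => //.
have lt_ba := embed_le e'.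
by have := leq_trans lt_ba le_ab; rewrite ltnn.
Qed.

Lemma embed_cat l a b c ts ss :
  embed l a ts b -> embed l b ss c -> embed l a (ts ++ ss) c.
Proof.
by elim=> //= a' b' c' ss' ts' le_ab lt_b lt_l e _ _ IH /IH; apply: embed_cons.
Qed.

Lemma embed_rcons l a b c ts ss :
  embed l a ts b -> b <= c -> c < size l ->
  (forall q, b <= q < c -> nth 0 l q < nth 0 l c) ->
  embed l 0 ss (nth 0 l c) -> embed l a (rcons ts (comb ss)) c.+1.
Proof.
move=> e le_bc lt_c lt_l es; rewrite -cats1; apply: embed_cat e _.
by apply: embed_cons le_bc lt_c lt_l es _; apply: embed_nil.
Qed.

Lemma embed_extend l l' a ts b : embed l a ts b -> embed (l ++ l') a ts b.
Proof.
elim=> [a'|a' b' c ss ts' le_ab lt_b lt_l _ IHs _ IHt]; first exact: embed_nil.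
have nthE q : q <= b' -> nth 0 (l ++ l') q = nth 0 l q.
  by move=> le_qb; rewrite nth_cat (leq_ltn_trans le_qb lt_b).
apply: (@embed_cons _ _ b') => //.
- by rewrite size_cat ltn_addr.
- move=> q /andP[le_aq lt_qb]; rewrite (nthE b') // (nthE q (ltnW lt_qb)).
  by apply: lt_l; rewrite le_aq.
- by rewrite nthE.
Qed.

Lemma term_comb ts : (forall t, t \in ts -> term t) -> term (comb ts).
Proof.
elim/last_ind: ts => [|ts t IH] tts; first exact: term_x.
rewrite comb_rcons; apply: term_op.
  by apply: IH => s s_ts; apply: tts; rewrite mem_rcons inE s_ts orbT.
by apply: tts; rewrite mem_rcons inE eqxx.
Qed.

Lemma embed_term l a ts b : embed l a ts b -> forall t, t \in ts -> term t.
Proof.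
elim=> // a' b' c ss ts' _ _ _ _ IHs _ IHt t; rewrite inE => /orP[/eqP->|].
  exact: term_comb.
exact: IHt.
Qed.

(* The one-step increments of [l] provide a place for each of the inserted
   prefixes, so an expansion of the algorithm never leaves [l]. *)
Lemma embed_extensions l ss ts x y i j us c : slow l ->
  embed l 0 ss x -> embed l x ts y -> i <= j -> j < size l ->
  nth 0 l i = x -> nth 0 l j = y ->
  (forall q, i <= q < j -> nth 0 l q < nth 0 l j) ->
  embed l j.+1 us c ->
  embed l i.+1 (extensions (comb ss) ts ++ us) c.
Proof.
move=> sl ess ets le_ij lt_j li lj lt_l eus; subst y.
elim: ts ss x i ess ets le_ij li lt_l => [|t ts IH] ss x i ess ets le_ij li lt_l.
  (* With nothing left to insert, [x] equals [l_j], so [i < j] would contradict [lt_l] at [i]. *)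
  inversion ets as [? xa nilE xj|] => /=; suff -> : i = j by [].
  apply/eqP; rewrite eqn_leq le_ij leqNgt; apply/negP=> lt_ij.
  by have := lt_l i; rewrite leqnn lt_ij li -xj ltnn => /(_ isT).
inversion ets as [|? b ? rs ? le_xb lt_b lt_lb ers ets']; subst.
(* The prefix ending with [comb rs] has index [b.+1] and goes where [l] first reaches that value. *)
have [|k [/andP[lt_ik le_kj] lk lt_lk]] := slow_ivt (x := b.+1) sl le_ij.
  by rewrite ltnS le_xb (embed_le ets').
set sr := rcons ss (comb rs).
have essr : embed l 0 sr b.+1 by apply: embed_rcons ess _ _ _ _.
have -> : extensions (comb ss) (comb rs :: ts)
    = comb sr :: extensions (comb sr) ts by rewrite /sr comb_rcons.
rewrite cat_cons; apply: (@embed_cons _ _ k) => //.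
- exact: leq_ltn_trans le_kj lt_j.
- by move=> q /andP[lt_iq lt_qk]; rewrite lk lt_lk // lt_qk ltnW.
- by rewrite lk.
- apply: IH essr ets' _ lk _ => // q /andP[le_kq lt_qj].
  by apply: lt_l; rewrite lt_qj andbT (leq_trans (ltnW lt_ik)).
Qed.

(** * Termination inside a slowly increasing sequence *)

(** The term [p] absorbs the arguments already matched. The run keeps the endpoints [b] and [c], so
    comparing them tells in advance which side ends as a prefix. *)
Definition resolves l a ts b ss c : Prop :=
  exists ts' ss',
    [/\ embed l a ts' b, embed l a ss' c,
        forall p, term p ->
          polish_reaches (p ++ args ts, p ++ args ss)
                         (p ++ args ts', p ++ args ss'),
        b <= c -> exists2 us, ss' = ts' ++ us & embed l b us c
      & c <= b -> exists2 us, ts' = ss' ++ us & embed l c us b].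

Lemma resolves_sym l a ts b ss c :
  resolves l a ts b ss c -> resolves l a ss c ts b.
Proof.
case=> ts' [ss' [ets ess run le_bc le_cb]]; exists ss', ts'; split=> // p tp.
exact: polish_reaches_sym (run p tp).
Qed.

Lemma resolves_cons l a i ss ts b us c ts0 us0 :
  a <= i -> i < size l -> (forall q, a <= q < i -> nth 0 l q < nth 0 l i) ->
  embed l 0 ss (nth 0 l i) ->
  (forall p, term p ->
     polish_reaches (p ++ args ts0, p ++ args us0)
                    (p ++ args (comb ss :: ts), p ++ args (comb ss :: us))) ->
  resolves l i.+1 ts b us c -> resolves l a ts0 b us0 c.
Proof.
move=> le_ai lt_i lt_l ess run [ts' [us' [ets eus run' le_bc le_cb]]].
exists (comb ss :: ts'), (comb ss :: us'); split.
- exact: embed_cons ets.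
- exact: embed_cons eus.
- move=> p tp; apply: polish_reaches_trans (run p tp) _.
  have tq : term (p ++ comb ss ++ [:: lstar]).
    by apply: term_op => //; apply/term_comb/(embed_term ess).
  by have := run' _ tq; rewrite !args_cons -!catA.
- by case/le_bc=> vs -> e; exists vs.
- by case/le_cb=> vs -> e; exists vs.
Qed.

Lemma resolves_nil l a ss c : embed l a ss c -> resolves l a [::] a ss c.
Proof.
move=> ess; exists [::], ss; split=> //; first exact: embed_nil.
- by move=> p _; apply: reaches_refl.
- by exists ss.
- move=> le_ca; have E : c = a.
    by apply/eqP; rewrite eqn_leq le_ca (embed_le ess).
  rewrite E in ess *; rewrite (embed_loop ess).
  by exists [::] => //; apply: embed_nil.
Qed.

(** Double induction. Heads at positions below [n] have indices below [n], since [l_i <= i]: the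
    outer induction on the bound of [b] and [c] applies. Tails keep that bound and start further
    right: the inner one on [n - a] applies. *)
Lemma embed_resolves l a ts b ss c : slow l ->
  embed l a ts b -> embed l a ss c -> resolves l a ts b ss c.
Proof.
move=> sl; have [n] := ubnP (maxn b c).
elim: n a ts b ss c => // n IHn a ts b ss c.
have [k] := ubnP (n - a); elim: k a ts b ss c => // k IHk a ts b ss c lt_k.
have heads rs qs i j : i < n -> j < n ->
    embed l 0 rs (nth 0 l i) -> embed l 0 qs (nth 0 l j) ->
    resolves l 0 rs (nth 0 l i) qs (nth 0 l j).
  move=> lt_in lt_jn; apply: IHn; rewrite gtn_max.
  by rewrite !(leq_ltn_trans (slow_le _ sl)).
have next i : a <= i -> i < n -> n - i.+1 < k.
  move=> le_ai lt_in; rewrite -ltnS; apply: leq_ltn_trans lt_k.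
  by rewrite ltn_sub2l // (leq_ltn_trans le_ai).
(* As [qs] skips position [i], [l_i < l_j], and the left head becomes a proper prefix of the right
   one. One expansion then puts it at [i] on both sides, without moving [c']. *)
have lt_case i j rs qs ts' b' ss' c' :
    maxn b' c' < n.+1 -> a <= i -> i < size l -> i < j -> j < size l ->
    (forall q, a <= q < i -> nth 0 l q < nth 0 l i) ->
    (forall q, a <= q < j -> nth 0 l q < nth 0 l j) ->
    embed l 0 rs (nth 0 l i) -> embed l 0 qs (nth 0 l j) ->
    embed l i.+1 ts' b' -> embed l j.+1 ss' c' ->
    resolves l a (comb rs :: ts') b' (comb qs :: ss') c'.
  move=> lt_max le_ai lt_i lt_ij lt_j lt_li lt_lj ers eqs ets ess.
  have [lt_bn lt_cn] : b' <= n /\ c' <= n.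
    by move: lt_max; rewrite ltnS geq_max => /andP.
  have lt_in := leq_trans (embed_le ets) lt_bn.
  have lt_jn := leq_trans (embed_le ess) lt_cn.
  have lt_lij : nth 0 l i < nth 0 l j by apply: lt_lj; rewrite le_ai.
  have [rs' [qs' [ers' eqs' run sub _]]] := heads _ _ _ _ lt_in lt_jn ers eqs.
  have [us qsE eus] := sub (ltnW lt_lij); subst qs'.
  have tus := embed_term eus.
  have ech : embed l i.+1 (extensions (comb rs') us ++ ss') c'.
    apply: (embed_extensions sl ers' eus (ltnW lt_ij) lt_j) ess => //.
    by move=> q /andP[le_iq lt_qj]; rewrite lt_lj // lt_qj (leq_trans le_ai).
  apply: (resolves_cons le_ai lt_i lt_li ers'); last first.
    by apply: IHk ets ech; rewrite ?next.
  move=> p tp.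
  have {}run := polish_reaches_context p (lstar :: args ts') (lstar :: args ss')
                  (run [:: lx] term_x).
  rewrite !args_cons; apply: polish_reaches_trans run _ => /=.
  apply/polish_reaches_sym/polish_reaches_expand.
  have trs := term_comb (embed_term ers').
  (* An empty remainder would make [l_i] and [l_j] equal. *)
  move: eus tus; case: us {sub eqs' ech} => [|u us] eus.
    by inversion eus as [? E1 nilE E|]; move: lt_lij; rewrite E ltnn.
  inversion eus; subst => tus.
  have := expand_args (args ss') (args ts') tp trs tus.
  by rewrite !args_cat /comb /= -!catA.
move=> lt_max ets ess; have lt_max' : maxn c b < n.+1 by rewrite maxnC.
have [lt_bn lt_cn] : b <= n /\ c <= n.
  by move: lt_max; rewrite ltnS geq_max => /andP.
inversion ets as [|? i ? rs ts' le_ai lt_i lt_li ers ets']; subst.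
  exact: resolves_nil.
inversion ess as [|? j ? qs ss' le_aj lt_j lt_lj eqs ess']; subst.
  by apply/resolves_sym/resolves_nil.
have [lt_ij|lt_ji|ij] := ltngtP i j; first exact: (lt_case i j).
  by apply/resolves_sym/(lt_case j i).
subst j.
have lt_in := leq_trans (embed_le ets') lt_bn.
(* Equal endpoints leave no remainder, so both heads become the same word. *)
have [rs' [qs' [ers' eqs' run sub _]]] := heads _ _ _ _ lt_in lt_in ers eqs.
have [us qsE /embed_loop E] := sub (leqnn _); subst us; rewrite cats0 in qsE.
subst qs'.
apply: (resolves_cons le_ai lt_i lt_li ers'); last first.
  by apply: IHk ets' ess'; rewrite ?next.
move=> p tp; rewrite !args_cons.
exact: polish_reaches_context (run [:: lx] term_x).
Qed.

Lemma embed_terminates l ts b ss c : slow l ->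
  embed l 0 ts b -> embed l 0 ss c -> polish_terminates (comb ts) (comb ss).
Proof.
move=> sl ets ess.
have [ts' [ss' [_ _ run le_bc le_cb]]] := embed_resolves sl ets ess.
exists (comb ts'), (comb ss'); split; first exact: run [:: lx] term_x.
case: (leqP b c) => [/le_bc[us -> _]|/ltnW/le_cb[us -> _]].
  by rewrite /comb args_cat -cat_cons first_diff_prefix.
by rewrite /comb args_cat -cat_cons first_diffC first_diff_prefix.
Qed.

(** * A sequence containing all small terms *)

Fixpoint ruler (N j : nat) : seq nat :=
  if j is j'.+1 then flatten (nseq N.+1 (ruler N j')) ++ [:: j] else [:: 0].

Fixpoint rulers (N K : nat) : seq nat :=
  if K is K'.+1 then rulers N K' ++ ruler N K else [::].

Lemma rulersS N K : rulers N K.+1 = rulers N K ++ ruler N K.+1.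
Proof. by []. Qed.

Lemma ruler_cat N j l :
  ruler N j.+1 ++ l = flatten (nseq N.+1 (ruler N j)) ++ j.+1 :: l.
Proof. by rewrite /= -!catA. Qed.

Lemma all_ruler N j : all (fun x => x <= j) (ruler N j).
Proof.
elim: j => // j IH.
have le_j : all (fun x => x <= j.+1) (ruler N j).
  by apply: sub_all IH => x /leqW.
have all_copies e : all (fun x => x <= j.+1) (flatten (nseq e (ruler N j))).
  by elim: e => //= e IHe; rewrite all_cat le_j.
by rewrite -[ruler N j.+1]cats0 ruler_cat all_cat all_copies /= leqnn.
Qed.

(** Any [x] may precede a ruler, which starts with [0]; its last entry [j] lets [j.+1] follow. *)
Lemma ruler_path N j x :
  path (fun y z => z <= y.+1) x (ruler N j) /\ last x (ruler N j) = j.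
Proof.
elim: j x => // j IH x.
have copies e y : path (fun y z => z <= y.+1) y (flatten (nseq e.+1 (ruler N j)))
    /\ last y (flatten (nseq e.+1 (ruler N j))) = j.
  elim: e y => [|e IHe] y; first by rewrite /= cats0.
  rewrite [nseq _ _]/= [flatten _]/= cat_path last_cat.
  have [-> ->] := IH y; exact: IHe.
rewrite -[ruler N j.+1]cats0 ruler_cat cat_path last_cat.
by have [-> ->] := copies N x; rewrite /= leqnn.
Qed.

Lemma rulers_path N K x : path (fun y z => z <= y.+1) x (rulers N K).
Proof.
elim: K => // K IH; rewrite rulersS.
by rewrite cat_path IH; have [] := ruler_path N K.+1 (last x (rulers N K)).
Qed.

Lemma ruler_head N j : nth 0 (ruler N j) 0 = 0 /\ 0 < size (ruler N j).
Proof.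
elim: j => // j [h s].
have -> : ruler N j.+1 = ruler N j ++ (flatten (nseq N (ruler N j)) ++ [:: j.+1]).
  by rewrite catA.
by rewrite nth_cat size_cat s ltn_addr.
Qed.

Lemma slow_rulers N K : slow (rulers N K).
Proof.
split.
  elim: K => // K IH; rewrite rulersS.
  by rewrite nth_cat; case: ltnP => // _; rewrite sub0n; case: (ruler_head N K.+1).
move=> q; case: (ltnP q.+1 (size (rulers N K))) => [lt_q|le_q]; last first.
  by rewrite nth_default.
by have /(pathP 0)/(_ _ lt_q) := rulers_path N K 0.
Qed.

(* With R_i for [ruler N i], [l] is (R_j)^(e_j) j+1 (R_(j+1))^(e_(j+1)) j+2 ... K
   where every exponent is at least [m]: there is room in [l] for [m] more
   arguments of arbitrary indices below [K]. *)
Inductive supply (N m : nat) : nat -> nat -> seq nat -> Prop :=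
| supply_nil K : supply N m K K [::]
| supply_cons j K e l : m <= e -> supply N m j.+1 K l ->
    supply N m j K (flatten (nseq e (ruler N j)) ++ j.+1 :: l).

Lemma supply_weaken N m m' j K l :
  m' <= m -> supply N m j K l -> supply N m' j K l.
Proof.
move=> le_m; elim=> [K'|j' K' e l' le_me _ IH]; first exact: supply_nil.
by apply: supply_cons => //; apply: leq_trans le_me.
Qed.

Lemma supply_extend N m j K l : m <= N.+1 -> supply N m j K l ->
  supply N m j K.+1 (l ++ ruler N K.+1).
Proof.
move=> le_m; elim=> [K'|j' K' e l' le_me _ IH].
  rewrite -[ruler _ _]cats0 ruler_cat; apply: supply_cons => //.
  exact: supply_nil.
by rewrite -catA; apply: supply_cons.
Qed.

Lemma supply_rulers N K : supply N N.+1 0 K (rulers N K).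
Proof.
elim: K => [|K IH]; first exact: supply_nil.
exact: supply_extend IH.
Qed.

(** Unfold [R_j] downwards: its first copy of [R_(j-1)] is unfolded further, the other [N >= m]
    copies form the block of level [j-1], and [R_0] finally joins the block of level [0]. *)
Lemma supply_ruler N m j K l : m <= N -> j < K ->
  supply N m j K l -> supply N m 0 K (ruler N j ++ l).
Proof.
move=> le_m; elim: j l => [|j IH] l lt_jK sl.
  inversion sl as [? E|? ? e l' le_me sl']; subst => //.
  exact: (@supply_cons N m 0 K e.+1 l' (leqW le_me) sl').
rewrite ruler_cat /= -catA; apply: IH; first exact: ltnW.
exact: supply_cons.
Qed.

Lemma supply_split N m j K l : j < K -> supply N m.+1 j K l ->
  exists2 l', l = ruler N j ++ l' & supply N m j K l'.
Proof.
move=> lt_jK sl; inversion sl as [? E|? ? [|e] l' le_me sl']; subst => //.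
  by rewrite ltnn in lt_jK.
exists (flatten (nseq e (ruler N j)) ++ j.+1 :: l'); first by rewrite /= -catA.
by apply: supply_cons => //; apply: supply_weaken sl'.
Qed.

Lemma supply_next N m i j K l : i < j -> j < K -> supply N m i K l ->
  exists pre l', [/\ l = pre ++ j :: l', all (fun x => x < j) pre
                   & supply N m j K l'].
Proof.
move=> lt_ij lt_jK sl; elim: sl lt_ij lt_jK => {i K l} [K|i K e l le_me sl IH].
  by move=> lt_Kj /(ltn_trans lt_Kj); rewrite ltnn.
move=> lt_ij lt_jK.
have lt_copies : all (fun x => x < j) (flatten (nseq e (ruler N i))).
  elim: e {le_me} => //= e IHe; rewrite all_cat IHe andbT.
  by apply: sub_all (all_ruler N i) => x /leq_ltn_trans->.
move: lt_ij; rewrite leq_eqVlt => /orP[/eqP ij|lt_ij].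
  by subst j; exists (flatten (nseq e (ruler N i))), l.
have [pre [l' [-> lt_pre sl']]] := IH lt_ij lt_jK.
exists (flatten (nseq e (ruler N i)) ++ i.+1 :: pre), l'; split=> //.
  by rewrite -catA.
by rewrite all_cat lt_copies /= lt_ij.
Qed.

(** Going to the first [j > 0] uses up the lower blocks; unfolding one copy of [R_j] behind it
    restores them, at the cost of one unit. For [j = 0] the unit is the entry itself. *)
Lemma supply_find N m j K l : m <= N -> j < K -> supply N m.+1 0 K l ->
  exists pre l', [/\ l = pre ++ j :: l', all (fun x => x < j) pre
                   & supply N m 0 K l'].
Proof.
move=> le_m lt_jK sl; case: (posnP j) => [j0|j_gt0].
  subst j; have [l' -> sl'] := supply_split lt_jK sl.
  by exists [::], l'.
have [pre [l' [-> lt_pre sl']]] := supply_next j_gt0 lt_jK sl.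
have [l2 E sl2] := supply_split lt_jK sl'; exists pre, l'; split=> //.
by rewrite E; apply: supply_ruler.
Qed.

(** * Placing every term in a frame *)

Definition fits N m K ts a : Prop :=
  [/\ embed (rulers N K) 0 ts a, a <= size (rulers N K)
    & supply N m 0 K (drop a (rulers N K))].

Lemma fits_extend N m K K' ts a : m <= N.+1 -> K <= K' ->
  fits N m K ts a -> fits N m K' ts a.
Proof.
move=> le_m; elim: K' => [|K' IH]; first by rewrite leqn0 => /eqP->.
rewrite leq_eqVlt => /orP[/eqP-> //|le_K] /(IH le_K)[e le_a sl].
rewrite /fits rulersS; split.
- exact: embed_extend.
- by rewrite size_cat (leq_trans le_a) ?leq_addr.
- move: (supply_extend le_m sl); rewrite drop_cat.
  move: le_a; rewrite leq_eqVlt => /orP[/eqP->|-> //].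
  by rewrite ltnn subnn drop0 drop_size.
Qed.

Lemma depth_gt0 w : term w -> 0 < depth w.
Proof.
by elim=> // s t _ ds _ _; rewrite /depth count_cat ltn_addr.
Qed.

(** Here [m] counts arguments still to come. In [st*] the left factor must take one more, paid for
    by the depth of [t], while [t] receives none. *)
Lemma term_fits N w : term w -> forall m, m + depth w <= N.+2 ->
  exists K ts a, w = comb ts /\ fits N m K ts a.
Proof.
elim=> [|s t hs IHs ht IHt] m.
  rewrite addn1 ltnS => le_m; exists 0, [::], 0; split=> //; split=> //.
    exact: embed_nil.
  exact: supply_weaken le_m (supply_rulers N 0).
have [ds dt] := (depth_gt0 hs, depth_gt0 ht).
rewrite /depth !count_cat /= !addn0 -!/(depth _) => le_m.
have le_mN : m <= N.
  have : m + 2 <= N.+2.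
    by apply: leq_trans le_m; rewrite leq_add2l (leq_add ds dt).
  by rewrite addn2.
have [|Ks [ss [a [-> fs]]]] := IHs m.+1.
  by apply: leq_trans le_m; rewrite addSnnS leq_add2l -addn1 leq_add2l.
have [|Kt [ts [b [-> ft]]]] := IHt 0.
  by apply: leq_trans le_m; rewrite addnA leq_addl.
(* The index [b] of the new argument must lie below the level of the frame, hence [b.+1]. *)
pose K := maxn (maxn Ks Kt) b.+1.
have [es le_a sup] : fits N m.+1 K ss a.
  by apply: fits_extend fs; rewrite // /K !leq_max leqnn.
have [et _ _] : fits N 0 K ts b.
  by apply: fits_extend ft; rewrite // /K !leq_max leqnn orbT.
have lt_bK : b < K by rewrite /K leq_max leqnn orbT.
have [pre [l' [dropE lt_pre sup']]] := supply_find le_mN lt_bK sup.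
have nthE q : nth 0 (rulers N K) (a + q) = nth 0 (pre ++ b :: l') q.
  by rewrite -dropE nth_drop.
pose c := a + size pre.
have cE : nth 0 (rulers N K) c = b by rewrite nthE nth_cat ltnn subnn.
have lt_c : c < size (rulers N K).
  rewrite -(cat_take_drop a (rulers N K)) dropE !size_cat /= size_takel //.
  by rewrite /c addnA addnS ltnS leq_addr.
exists K, (rcons ss (comb ts)), c.+1; split; first by rewrite comb_rcons.
split=> //.
- apply: embed_rcons es _ lt_c _ _; rewrite ?leq_addr ?cE //.
  move=> q /andP[le_aq]; rewrite -(subnKC le_aq) ltn_add2l nthE => lt_q.
  by rewrite nth_cat lt_q; apply: (allP lt_pre); apply: mem_nth.
- by rewrite /c -addnS addnC -drop_drop dropE drop_cat ltnNge leqnSn /=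
    subSnn drop1.
Qed.

Theorem polish_terminates_term u v : term u -> term v -> polish_terminates u v.
Proof.
move=> tu tv; pose N := maxn (depth u) (depth v).
have [|K1 [ts [a [-> fu]]]] := @term_fits N _ tu 0.
  by rewrite add0n ltnW // ltnW // !ltnS leq_maxl.
have [|K2 [ss [b [-> fv]]]] := @term_fits N _ tv 0.
  by rewrite add0n ltnW // ltnW // !ltnS leq_maxr.
have [eu _ _] := fits_extend (leq0n _) (leq_maxl K1 K2) fu.
have [ev _ _] := fits_extend (leq0n _) (leq_maxr K1 K2) fv.
exact: embed_terminates (slow_rulers _ _) eu ev.
Qed.

Theorem theorem5p1 (u v : word) (hu : term u) (hv : term v)
    (du : depth u <= 10) (dv : depth v <= 10) :
  polish_terminates u v.
Proof. exact: polish_terminates_term. Qed.
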